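(* Let $G$ be a finite group. The class function $\varphi_{-1}:G\to\mathbb{Z}$, $g\mapsto\varphi^{-1}(\langle g\rangle,G)$, is an integral linear combination of irreducible characters of $G$.
   Context: For a finite group $G$, let $\mathcal{L}(G)$ be its set of subgroups, partially ordered by inclusion ($\leq$). The incidence algebra $\mathcal{W}(G)$ is the ring of functions $f:\mathcal{L}(G)\times\mathcal{L}(G)\to\mathbb{Z}$ with $f(H,K)=0$ whenever $H\not\leq K$, with pointwise addition and the convolution product $(f*h)(H,K)=\sum_{H\leq L\leq K}f(H,L)\,h(L,K)$; its unit element is $\delta$, with $\delta(H,K)=1$ if $H=K$ and $0$ otherwise. The zeta function $\zeta\in\mathcal{W}(G)$ has $\zeta(H,K)=1$ if $H\leq K$ and $0$ otherwise, and $\mu=\zeta^{-1}$ is the Möbius function. The index function $i\in\mathcal{W}(G)$ is $i(H,K)=[K:H]$ if $H\leq K$ and $0$ otherwise. The Euler totient function for $G$ is $\varphi=i*\mu\in\mathcal{W}(G)$; it is invertible in $\mathcal{W}(G)$, and $\varphi^{-1}$ denotes its inverse with respect to convolution. Here $\langle g\rangle$ is the cyclic subgroup generated by $g$, and characters are ordinary (complex) characters. *)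

(* Defs.v *)
From HB Require Import structures.
From mathcomp Require Import all_boot all_order all_algebra all_fingroup.
From mathcomp Require Import all_solvable all_field all_character.

Set Implicit Arguments.
Unset Strict Implicit.
Unset Printing Implicit Defensive.

Import GRing.Theory.
Local Open Scope ring_scope.

Section SubgroupLattice.

Variables (gT : finGroupType) (G : {group gT}).

Record subgrp := Subgrp {
  subgrp_group :> {group gT};
  subgrp_sub : subgrp_group \subset G
}.

HB.instance Definition _ := [isSub for subgrp_group].
HB.instance Definition _ := [Finite of subgrp by <:].

Definition subgrp_full : subgrp := Subgrp (subxx G).

(* For g outside G, where <[g]> is not a subgroup of G, this is G. *)
Definition subgrp_cycle (g : gT) : subgrp := insubd subgrp_full <[g]>%G.

Lemma subgrp_cycleE g : g \in G -> subgrp_cycle g = <[g]>%G :> {group gT}.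
Proof. by move=> Gg; rewrite /subgrp_cycle insubdK // unfold_in /= cycle_subG. Qed.

Lemma subgrp_eqEsubset (H K : subgrp) :
  (H == K) = (H \subset K) && (K \subset H).
Proof. by rewrite -val_eqE /= -val_eqE /= eqEsubset. Qed.

Definition incidence_supp : {pred {ffun subgrp * subgrp -> int}} :=
  [pred f : {ffun subgrp * subgrp -> int} |
     [forall H : subgrp, forall K : subgrp,
        ~~ (H \subset K) ==> (f (H, K) == 0)]].

Record incidence := Incidence {
  incidence_val : {ffun subgrp * subgrp -> int};
  _ : incidence_val \in incidence_supp
}.

HB.instance Definition _ := [isSub for incidence_val].
HB.instance Definition _ := [Choice of incidence by <:].

Lemma incidence_suppP (f : {ffun subgrp * subgrp -> int}) :
  reflect (forall H K : subgrp, ~~ (H \subset K) -> f (H, K) = 0)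
          (f \in incidence_supp).
Proof.
apply: (iffP forallP) => [f0 H K nHK | f0 H].
  by apply/eqP; move/forallP/(_ K)/implyP: (f0 H); apply.
by apply/forallP=> K; apply/implyP=> nHK; rewrite f0.
Qed.

Fact incidence_zmod_closed : zmod_closed incidence_supp.
Proof.
split=> [|f h /incidence_suppP f0 /incidence_suppP h0].
  by apply/incidence_suppP=> H K _; rewrite ffunE.
by apply/incidence_suppP=> H K nHK; rewrite !ffunE f0 ?h0 ?subr0.
Qed.
HB.instance Definition _ :=
  GRing.isZmodClosed.Build _ incidence_supp incidence_zmod_closed.
HB.instance Definition _ := [SubChoice_isSubZmodule of incidence by <:].

Definition incidence_app (f : incidence) (H K : subgrp) : int :=
  incidence_val f (H, K).
Coercion incidence_app : incidence >-> Funclass.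

Definition incidence_of (f : subgrp -> subgrp -> int) : incidence :=
  insubd (0 : incidence)
    [ffun HK : subgrp * subgrp => f HK.1 HK.2 *+ (HK.1 \subset HK.2)].

Lemma incidence_ofE f H K : incidence_of f H K = f H K *+ (H \subset K).
Proof.
rewrite /incidence_app /incidence_of -[incidence_val _]/(\val _).
rewrite insubdK ?ffunE //.
by apply/incidence_suppP=> H' K' /negPf nHK; rewrite ffunE /= nHK.
Qed.

Lemma incidence_out (f : incidence) (H K : subgrp) :
  ~~ (H \subset K) -> f H K = 0.
Proof. by move: H K; apply/incidence_suppP; case: f. Qed.

Lemma incidenceP (f h : incidence) : (forall H K, f H K = h H K) <-> f = h.
Proof.
split=> [fh | -> //]; apply/val_inj/ffunP=> -[H K]; exact: fh.
Qed.

Lemma incidence_addE (f h : incidence) H K : (f + h) H K = f H K + h H K.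
Proof. by rewrite /incidence_app /= ffunE. Qed.

Definition incidence_one : incidence :=
  incidence_of (fun H K => (H == K)%:R).

Definition incidence_mul (f h : incidence) : incidence :=
  incidence_of (fun H K =>
    \sum_(L : subgrp | (H \subset L) && (L \subset K)) f H L * h L K).

Lemma incidence_oneE H K : incidence_one H K = (H == K)%:R.
Proof.
by rewrite incidence_ofE; have [->|] := eqVneq H K; rewrite ?subxx ?mul0rn.
Qed.

Lemma incidence_mulE f h H K :
  incidence_mul f h H K =
  \sum_(L : subgrp | (H \subset L) && (L \subset K)) f H L * h L K.
Proof.
rewrite incidence_ofE; have [//|nHK] := boolP (H \subset K).
rewrite mulr0n big1 // => L /andP[HL LK].
by rewrite (subset_trans HL LK) in nHK.
Qed.

Lemma incidence_mulET f h H K :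
  incidence_mul f h H K = \sum_L f H L * h L K.
Proof.
rewrite incidence_mulE [RHS](bigID (fun L : subgrp =>
  (H \subset L) && (L \subset K))) /= [X in _ + X]big1 ?addr0 // => L.
by rewrite negb_and => /orP[] /incidence_out->; rewrite ?mul0r ?mulr0.
Qed.

Fact incidence_mulA : associative incidence_mul.
Proof.
move=> f h k; apply/incidenceP=> H K; rewrite !incidence_mulET.
under eq_bigr do rewrite incidence_mulET mulr_sumr.
rewrite exchange_big; apply: eq_bigr => L _.
by rewrite incidence_mulET mulr_suml; apply: eq_bigr => M _; rewrite mulrA.
Qed.

Fact incidence_mul1l : left_id incidence_one incidence_mul.
Proof.
move=> f; apply/incidenceP=> H K; rewrite incidence_mulET (bigD1 H) //=.
rewrite incidence_oneE eqxx mul1r big1 ?addr0 // => L /negPf nLH.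
by rewrite incidence_oneE eq_sym nLH mul0r.
Qed.

Fact incidence_mul1r : right_id incidence_one incidence_mul.
Proof.
move=> f; apply/incidenceP=> H K; rewrite incidence_mulET (bigD1 K) //=.
rewrite incidence_oneE eqxx mulr1 big1 ?addr0 // => L /negPf nLK.
by rewrite incidence_oneE nLK mulr0.
Qed.

Fact incidence_mulDl : left_distributive incidence_mul +%R.
Proof.
move=> f h k; apply/incidenceP=> H K.
rewrite incidence_addE !incidence_mulET -big_split.
by apply: eq_bigr => L _; rewrite incidence_addE mulrDl.
Qed.

Fact incidence_mulDr : right_distributive incidence_mul +%R.
Proof.
move=> f h k; apply/incidenceP=> H K.
rewrite incidence_addE !incidence_mulET -big_split.
by apply: eq_bigr => L _; rewrite incidence_addE mulrDr.
Qed.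

Fact incidence_one_neq0 : incidence_one != 0.
Proof.
apply/eqP=> /incidenceP/(_ subgrp_full subgrp_full)/eqP.
by rewrite incidence_oneE eqxx /incidence_app /= ffunE.
Qed.

HB.instance Definition _ := GRing.Zmodule_isNzRing.Build incidence
  incidence_mulA incidence_mul1l incidence_mul1r
  incidence_mulDl incidence_mulDr incidence_one_neq0.

(* The units of the incidence algebra are the functions whose diagonal
   values are units; the inverse is obtained by solving inv f * f = 1 for
   the value at (H, K), recursively on K. *)
Definition incidence_unit : {pred incidence} :=
  [pred f : incidence | [forall H : subgrp, f H H \is a GRing.unit]].

Fixpoint incidence_inv_rec (n : nat) (f : incidence) (H K : subgrp) : int :=
  if n is n'.+1 then
    ((H == K)%:R - \sum_(L : subgrp | (H \subset L) && (L \proper K))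
                      incidence_inv_rec n' f H L * f L K) / f K K
  else 0.

Definition incidence_inv (f : incidence) : incidence :=
  if f \in incidence_unit then
    incidence_of (fun H K => incidence_inv_rec #|K| f H K)
  else f.

Lemma incidence_inv_rec_indep n f (H K : subgrp) :
  (#|K| <= n)%N -> incidence_inv_rec n f H K = incidence_inv_rec #|K| f H K.
Proof.
elim/ltn_ind: n K => -[|n] IHn K; first by rewrite leqNgt cardG_gt0.
move=> leKn; have: (0 < #|K|)%N by exact: cardG_gt0.
case DK: #|K| => [//|m] _ /=; rewrite DK ltnS in leKn; congr (_ * _).
congr (_ - _); apply: eq_bigr => L /andP[_ /proper_card]; rewrite DK ltnS => Lm.
congr (_ * _).
by rewrite (IHn n) ?(IHn m) ?(leq_trans Lm).
Qed.

Lemma incidence_mulVl f :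
  f \in incidence_unit -> incidence_mul (incidence_inv f) f = incidence_one.
Proof.
move=> Uf; apply/incidenceP=> H K.
have [sHK | nsHK] := boolP (H \subset K); last first.
  by rewrite !incidence_out.
rewrite incidence_mulE incidence_oneE (bigD1 K) ?sHK ?subxx //=.
rewrite /incidence_inv Uf incidence_ofE sHK mulr1n.
have Kgt0: (0 < #|K|)%N by exact: cardG_gt0.
case DK: #|K| Kgt0 => [//|n] _ /=; rewrite divrK ?(forallP Uf) //.
rewrite -[RHS](subrK (\sum_(L : subgrp | (H \subset L) && (L \proper K))
                      incidence_inv_rec n f H L * f L K)).
congr (_ + _); apply: eq_big => [L | L /andP[/andP[sHL sLK] neLK]].
  by rewrite subgrp_eqEsubset properE -andbA; case: (L \subset K).
rewrite incidence_ofE sHL mulr1n [in RHS]incidence_inv_rec_indep //.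
have: L \proper K.
  by rewrite properE sLK; move: neLK; rewrite subgrp_eqEsubset sLK.
by move/proper_card; rewrite DK.
Qed.

Lemma incidence_diagM (f h : incidence) H : (f * h) H H = f H H * h H H.
Proof.
rewrite [LHS]incidence_mulE (big_pred1 H) // => L.
by rewrite /= subgrp_eqEsubset andbC.
Qed.

Lemma incidence_inv_unit f :
  f \in incidence_unit -> incidence_inv f \in incidence_unit.
Proof.
move=> Uf; apply/forallP=> H.
have /incidenceP/(_ H H) := incidence_mulVl Uf.
rewrite [LHS]incidence_diagM incidence_oneE eqxx => fV.
by apply/unitrP; exists (f H H); rewrite mulrC fV.
Qed.

Fact incidence_mulVr : {in incidence_unit, left_inverse 1 incidence_inv *%R}.
Proof. by move=> f; apply: incidence_mulVl. Qed.

Fact incidence_divrr : {in incidence_unit, right_inverse 1 incidence_inv *%R}.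
Proof.
move=> f Uf; have Vf := incidence_mulVr Uf.
have VVf := incidence_mulVr (incidence_inv_unit Uf).
suff ef : f = incidence_inv (incidence_inv f) by rewrite [X in X * _]ef.
by rewrite -[LHS]mul1r -VVf -mulrA Vf mulr1.
Qed.

Fact incidence_unitP (f h : incidence) :
  h * f = 1 /\ f * h = 1 -> f \in incidence_unit.
Proof.
move=> [hf fh]; apply/forallP=> H; apply/unitrP; exists (h H H).
by rewrite -!incidence_diagM hf fh incidence_oneE eqxx.
Qed.

Fact incidence_inv_out : {in [predC incidence_unit], incidence_inv =1 id}.
Proof. by move=> f; rewrite inE /= /incidence_inv => /negPf->. Qed.

HB.instance Definition _ := GRing.NzRing_hasMulInverse.Build incidence
  incidence_mulVr incidence_divrr incidence_unitP incidence_inv_out.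

Definition inc_zeta : incidence := incidence_of (fun H K => 1).

Definition inc_mu : incidence := inc_zeta^-1.

Definition inc_index : incidence := incidence_of (fun H K => #|K : H|%g%:R).

Definition inc_totient : incidence := inc_index * inc_mu.

(* In a unitRingType, x^-1 = x for a non-unit x, so the inverses in inc_mu and
   inc_totient^-1 are meaningful because of the next two lemmas. *)
Lemma inc_zeta_unit : inc_zeta \is a GRing.unit.
Proof. by apply/forallP=> H; rewrite incidence_ofE subxx. Qed.

Lemma inc_totient_unit : inc_totient \is a GRing.unit.
Proof.
have Ui : inc_index \is a GRing.unit.
  by apply/forallP=> H; rewrite incidence_ofE subxx indexgg.
by rewrite unitrMl ?unitrV ?inc_zeta_unit.
Qed.

Definition totient_inv (g : gT) : int :=
  inc_totient^-1 (subgrp_cycle g) subgrp_full.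

Section Conjugation.

Variables (x : gT) (Gx : x \in G).

Fact subgrp_conj_sub (H : subgrp) : (H :^ x)%G \subset G.
Proof. by rewrite /= -(conjGid Gx) conjSg subgrp_sub. Qed.
Definition subgrp_conj (H : subgrp) : subgrp := Subgrp (subgrp_conj_sub H).

Lemma subgrp_conj_inj : injective subgrp_conj.
Proof.
by move=> H K /(congr1 (fun L : subgrp => (L : {set gT}))) /= /conjsg_inj;
  move=> eHK; apply/val_inj/val_inj.
Qed.

Definition incidence_conj (f : incidence) : incidence :=
  incidence_of (fun H K => f (subgrp_conj H) (subgrp_conj K)).

Lemma incidence_conjE f H K :
  incidence_conj f H K = f (subgrp_conj H) (subgrp_conj K).
Proof.
rewrite incidence_ofE; have [//|nHK] := boolP (H \subset K).
by rewrite incidence_out //= conjSg.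
Qed.

Lemma incidence_conjM f h :
  incidence_conj (f * h) = incidence_conj f * incidence_conj h.
Proof.
apply/incidenceP=> H K; rewrite incidence_conjE [LHS]incidence_mulET [RHS]incidence_mulET.
rewrite (reindex_inj subgrp_conj_inj); apply: eq_bigr => L _.
by rewrite !incidence_conjE.
Qed.

Lemma incidence_conj1 : incidence_conj 1 = 1.
Proof.
apply/incidenceP=> H K; rewrite incidence_conjE !incidence_oneE.
by rewrite (inj_eq subgrp_conj_inj).
Qed.

Lemma incidence_conjV f :
  f \is a GRing.unit -> incidence_conj f = f -> incidence_conj f^-1 = f^-1.
Proof.
move=> Uf Jf; apply: (mulrI Uf); rewrite divrr // -{1}Jf -incidence_conjM.
by rewrite divrr // incidence_conj1.
Qed.

Lemma inc_totient_conj : incidence_conj inc_totient = inc_totient.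
Proof.
have Ji : incidence_conj inc_index = inc_index.
  apply/incidenceP=> H K; rewrite incidence_conjE !incidence_ofE /=.
  by rewrite conjSg indexJg.
have Jz : incidence_conj inc_zeta = inc_zeta.
  by apply/incidenceP=> H K; rewrite incidence_conjE !incidence_ofE /= conjSg.
by rewrite incidence_conjM Ji (incidence_conjV inc_zeta_unit Jz).
Qed.

End Conjugation.

Lemma totient_invJ : {in G &, forall g x, totient_inv (g ^ x)%g = totient_inv g}.
Proof.
move=> g x Gg Gx; rewrite /totient_inv.
rewrite -[in RHS](incidence_conjV inc_totient_unit (inc_totient_conj Gx)).
rewrite incidence_conjE; congr (_ _ _); apply/val_inj/val_inj.
  by rewrite /= !subgrp_cycleE ?groupJ //= cycleJ.
by rewrite /= conjGid.
Qed.

Fact totient_inv_class_fun :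
  is_class_fun <<G>>%g [ffun g => (totient_inv g)%:~R *+ (g \in G)].
Proof.
rewrite genGid; apply: intro_class_fun => [g x Gg Gx | g /negPf-> //].
by rewrite groupJr // totient_invJ.
Qed.
Definition totient_inv_cfun : 'CF(G) := Cfun 0 totient_inv_class_fun.

Lemma totient_inv_cfunE g : g \in G -> totient_inv_cfun g = (totient_inv g)%:~R.
Proof. by move=> Gg; rewrite cfunE Gg. Qed.

End SubgroupLattice.

(* Main.v *)
(** Since [K : H] is multiplicative along chains, the inverse of the index
    function is [K : H] mu(H, K), whence
      phi^-1(<g>, G) = \sum_(g \in L <= G) [G : L] mu(L, G).
    As mu(L, G) depends only on the conjugacy class of L, averaging over
    conjugation by G rewrites the right-hand side as the value at g of
      \sum_(L <= G) mu(L, G) Ind_L^G 1. *)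
Require Import Defs.
From mathcomp Require Import all_boot all_order all_algebra all_fingroup.
From mathcomp Require Import all_solvable all_field all_character.

Set Implicit Arguments.
Unset Strict Implicit.
Unset Printing Implicit Defensive.

Import GRing.Theory Num.Theory.
Local Open Scope ring_scope.

Section TotientInverse.

Variables (gT : finGroupType) (G : {group gT}).
Implicit Types H K L : subgrp G.

Lemma inc_index_unit : inc_index G \is a GRing.unit.
Proof. by apply/forallP=> H; rewrite incidence_ofE subxx indexgg. Qed.

(** The value at [(H, K)] of zeta * mu = 1. *)
Lemma sum_inc_mu H K :
  \sum_(L : subgrp G | (H \subset L) && (L \subset K)) inc_mu G L K
    = (H == K)%:R.
Proof.
have /incidenceP/(_ H K) := divrr (inc_zeta_unit G).
rewrite [LHS]incidence_mulE [RHS]incidence_oneE => <-.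
by apply: eq_bigr => L /andP[sHL _]; rewrite incidence_ofE sHL mul1r.
Qed.

Lemma inc_index_inv H K :
  (inc_index G)^-1 H K = #|K : H|%g%:R * inc_mu G H K.
Proof.
have [sHK | nsHK] := boolP (H \subset K); last first.
  by rewrite !incidence_out ?mulr0.
set j := incidence_of (fun H K => #|K : H|%g%:R * inc_mu G H K).
suff ->: (inc_index G)^-1 = j by rewrite incidence_ofE sHK.
apply: (mulrI inc_index_unit); rewrite divrr ?inc_index_unit //.
apply/incidenceP=> {sHK}H {}K; rewrite [RHS]incidence_mulE [LHS]incidence_oneE.
(* The product [L : H] [K : L] = [K : H] does not depend on [L], so it leaves the sum. *)
under eq_bigr => L /andP[sHL sLK].
  rewrite !incidence_ofE sHL sLK /= mulrA -natrM mulnC Lagrange_index //.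
  over.
rewrite -mulr_sumr sum_inc_mu.
by case: eqP => [->|_]; rewrite ?indexgg ?mulr1 ?mulr0.
Qed.

(** Inverting [inc_index * inc_mu] gives zeta convolved with the inverse index function. *)
Lemma inc_totient_inv H :
  (inc_totient G)^-1 H (subgrp_full G) =
    \sum_(L : subgrp G | H \subset L)
      #|G : L|%g%:R * inc_mu G L (subgrp_full G).
Proof.
rewrite invrM ?inc_index_unit ?unitrV ?inc_zeta_unit // invrK.
rewrite [LHS]incidence_mulE; apply: eq_big => [L | L /andP[sHL _]].
  by rewrite subgrp_sub andbT.
by rewrite incidence_ofE sHL mul1r inc_index_inv.
Qed.

(** Conjugation by [x] is an automorphism of the subgroup lattice that fixes [G], so it preserves
    zeta and hence its inverse. *)
Lemma inc_mu_conj x (Gx : x \in G) L :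
  inc_mu G (subgrp_conj Gx L) (subgrp_full G) = inc_mu G L (subgrp_full G).
Proof.
have Jz : incidence_conj Gx (inc_zeta G) = inc_zeta G.
  by apply/incidenceP=> H K; rewrite incidence_conjE !incidence_ofE /= conjSg.
rewrite /inc_mu -[in RHS](incidence_conjV (inc_zeta_unit G) Jz) incidence_conjE.
by congr (_ _ _); apply/val_inj/val_inj; rewrite /= conjGid.
Qed.

Lemma totient_inv_cfun_sum_Ind :
  totient_inv_cfun G =
    \sum_(L : subgrp G) 'Ind[G, L] 1 *~ inc_mu G L (subgrp_full G).
Proof.
pose c L : algC := (inc_mu G L (subgrp_full G))%:~R.
apply/cfun_inP=> g Gg; rewrite totient_inv_cfunE // sum_cfunE.
transitivity (\sum_(L : subgrp G) \sum_(y in G)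
                #|L|%:R^-1 * (c L *+ (g ^ y \in L)%g)).
  rewrite exchange_big /=.
  (* Replacing [L] by its conjugate under [y] makes the inner sum independent of [y]; the |G| equal
     terms then turn 1/|L| into [G : L]. *)
  transitivity
    (\sum_(y in G) \sum_(L : subgrp G) #|L|%:R^-1 * (c L *+ (g \in L)) : algC);
    last first.
    apply: eq_bigr => y Gy.
    rewrite [RHS](reindex_inj (@subgrp_conj_inj _ _ _ Gy)).
    by apply: eq_bigr => L _; rewrite /= cardJg memJ_conjg /c inc_mu_conj.
  rewrite sumr_const -mulr_natl mulr_sumr /totient_inv inc_totient_inv.
  rewrite rmorph_sum /= big_mkcond; apply: eq_bigr => L _.
  rewrite subgrp_cycleE //= cycle_subG; case: (g \in L); last by rewrite !mulr0.
  by rewrite rmorphM rmorph_nat mulrA -natf_indexg ?subgrp_sub.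
(* For fixed [L], the sum over [y] is the induced character formula for the trivial character of
   [L]. *)
apply: eq_bigr => L _; rewrite -mulr_sumr -scaler_int cfunE.
rewrite cfIndE ?subgrp_sub // mulrCA; congr (_ * _); rewrite mulr_sumr.
by apply: eq_bigr => y _; rewrite cfun1E mulr_natr.
Qed.

End TotientInverse.

Theorem proposition6p2 (gT : finGroupType) (G : {group gT}) :
  totient_inv_cfun G \in 'Z[irr G]%g.
Proof.
rewrite totient_inv_cfun_sum_Ind; apply: rpred_sum => L _; apply: rpredMz.
by apply: char_vchar; apply: cfInd_char; apply: cfun1_char.
Qed.
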